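(* Let $A\in\mathbb{R}^{d\times d}$ be diagonalizable (over $\mathbb{C}$) with all eigenvalues having strictly negative real part, let $B\in\mathbb{R}^{d\times r}$ with $d\ge r$, possibly rank-deficient, be such that no left eigenvector of $A$ lies in the kernel of $B^\top$, and let $Q=\frac12BB^\top$. Let $$\mathcal{A}\psi=\sum_{i=1}^d (Ax)_i\frac{\partial\psi}{\partial x_i}+\sum_{i,j=1}^dQ_{ij}\frac{\partial^2\psi}{\partial x_i\partial x_j}$$ be the associated Ornstein--Uhlenbeck operator. Let $f_1,\dots,f_d\in\mathbb{C}^d$ be a basis of left eigenvectors of $A$, $f_k^*A=-\lambda_kf_k^*$, and for $\mathbf n\in\mathbb{N}_0^d$ put $$\psi_{\mathbf n}(x)=\prod_{k=1}^d\langle x,f_k\rangle^{n_k},\qquad \mu_{\mathbf n}=-\sum_{k=1}^dn_k\overline{\lambda_k}.$$ Then for every $\mathbf n\in\mathbb{N}_0^d$, $$\mathcal{A}\psi_{\mathbf n}=\mu_{\mathbf n}\psi_{\mathbf n}+\sum_{k=1}^d\langle\overline{f_k},Qf_k\rangle\,n_k(n_k-1)\,\psi_{\mathbf m^{(k)}}+2\sum_{k=1}^d\sum_{j=k+1}^d\langle\overline{f_j},Qf_k\rangle\,n_kn_j\,\psi_{\mathbf m^{(kj)}},$$ where $\mathbf m^{(k)}$ agrees with $\mathbf n$ except that its $k$-th entry is $n_k-2$, and $\mathbf m^{(kj)}$ agrees with $\mathbf n$ except that its $k$-th entry is $n_k-1$ and its $j$-th entry is $n_j-1$ (terms whose numerical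 coefficient $n_k(n_k-1)$ or $n_kn_j$ vanishes are taken to be zero). In particular: (i) $\mathcal{A}\psi_{\mathbf n}$ is a linear combination of at most $\frac12(d^2+d+2)$ of the functions $\psi_{\mathbf m}$; (ii) for each $\mathbf n\in\mathbb{N}_0^d$, the span of the $N=\prod_{k=1}^d(n_k+1)$ functions $\psi_{\mathbf m}$ with $0\le m_k\le n_k$ for all $k$ is invariant under $\mathcal{A}$, and, when these functions are ordered by increasing lexicographic order of their indices, the $N\times N$ matrix $\mathbf M$ representing $\mathcal{A}$ (whose columns are the coordinates of the functions $\mathcal{A}\psi_{\mathbf m}$) is upper triangular.
   Context: $\langle u,v\rangle=u^*v$, where $^*$ is the conjugate transpose, so $\langle x,f\rangle=x^\top f$ for $x\in\mathbb{R}^d$, and $\langle\overline{f},Qg\rangle=f^\top Qg$. $\mathbb{N}_0$ is the set of nonnegative integers. The operator $\mathcal{A}$ acts on complex-valued functions of $x\in\mathbb{R}^d$. *)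

(* Defs.v *)
From HB Require Import structures.
From mathcomp Require Import all_boot all_order all_algebra.
From mathcomp Require Import all_classical all_reals all_analysis.
From mathcomp Require Import complex.

Set Implicit Arguments.
Unset Strict Implicit.
Unset Printing Implicit Defensive.

Import Order.TTheory GRing.Theory Num.Theory numFieldNormedType.Exports.
Local Open Scope ring_scope.
Local Open Scope sesquilinear_scope.

Definition cplx (R : realType) (m n : nat) (M : 'M[R]_(m, n)) : 'M[R[i]]_(m, n) :=
  map_mx (real_complex R) M.

(* <u, v> = u^* v, conjugate-linear in the first argument. *)
Definition hdot (R : realType) (d : nat) (u v : 'cV[R[i]]_d) : R[i] :=
  (u^t* *m v) 0 0.

(* Partial derivative along x_i of a complex-valued function of x in R^d.
   R[i] carries no normed R-module structure in the library, so the real and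
   imaginary parts are differentiated separately. *)
Definition pderiv (R : realType) (d : nat) (i : 'I_d)
    (phi : 'cV[R]_d -> R[i]) (x : 'cV[R]_d) : R[i] :=
  (('D_(delta_mx i 0) (fun y => complex.Re (phi y)) x)
   +i* ('D_(delta_mx i 0) (fun y => complex.Im (phi y)) x))%C.

Definition diffusion (R : realType) (d r : nat) (B : 'M[R]_(d, r)) : 'M[R]_d :=
  2^-1 *: (B *m B^T).

Definition OU (R : realType) (d r : nat) (A : 'M[R]_d) (B : 'M[R]_(d, r))
    (phi : 'cV[R]_d -> R[i]) (x : 'cV[R]_d) : R[i] :=
  \sum_(i < d) ((A *m x) i 0)%:C%C * pderiv i phi x
  + \sum_(i < d) \sum_(j < d)
      (diffusion B i j)%:C%C * pderiv i (pderiv j phi) x.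

(* Multi-indices in N_0^d, totally ordered by the lexicographic order
   (entry 0 is the most significant one). *)
Definition mindex (d : nat) := d.-tuplelexi nat.

Definition psi (R : realType) (d : nat) (f : 'I_d -> 'cV[R[i]]_d)
    (n : mindex d) (x : 'cV[R]_d) : R[i] :=
  \prod_(k < d) hdot (cplx x) (f k) ^+ tnth n k.

Definition mu (R : realType) (d : nat) (lambda : 'I_d -> R[i])
    (n : mindex d) : R[i] :=
  - \sum_(k < d) (tnth n k)%:R * (lambda k)^*.

(* In the next two definitions the subtraction is truncated; it only differs
   from the true one where n_k (n_k - 1), resp. n_k n_j, vanishes. *)
Definition lower2 (d : nat) (n : mindex d) (k : 'I_d) : mindex d :=
  [tuple (if l == k then tnth n l - 2 else tnth n l)%N | l < d].

Definition lower11 (d : nat) (n : mindex d) (k j : 'I_d) : mindex d :=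
  [tuple (if (l == k) || (l == j) then tnth n l - 1 else tnth n l)%N | l < d].

(* The multi-indices m with m_k <= n_k for all k, in increasing
   lexicographic order. *)
Definition lexbox (d : nat) (n : mindex d) : seq (mindex d) :=
  sort <=%O
    [seq ([tuple (g k : nat) | k < d] : mindex d)
       | g : {dffun forall k : 'I_d, 'I_(tnth n k).+1}].

Definition psi_comb (R : realType) (d : nat) (f : 'I_d -> 'cV[R[i]]_d)
    (s : seq (mindex d)) (c : mindex d -> R[i]) (x : 'cV[R]_d) : R[i] :=
  \sum_(m <- s) c m * psi f m x.

(* Column j of M holds the coordinates of OU A B psi_m in the functions
   (psi_p), p in s, where m is the j-th element of s. *)
Definition represents (R : realType) (d r : nat) (A : 'M[R]_d)
    (B : 'M[R]_(d, r)) (f : 'I_d -> 'cV[R[i]]_d) (n : mindex d) (N : nat)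
    (M : 'M[R[i]]_N) : Prop :=
  forall (j : 'I_N) (x : 'cV[R]_d),
    OU A B (psi f (nth n (lexbox n) j)) x =
    \sum_(i < N) M i j * psi f (nth n (lexbox n) i) x.

Lemma mem_lexbox (d : nat) (n m : mindex d) :
  (m \in lexbox n) = [forall k, (tnth m k <= tnth n k)%N].
Proof.
rewrite mem_sort; apply/fintype.imageP/forallP => [[g _ ->] k|le_mn].
  by rewrite tnth_mktuple -ltnS.
exists [ffun k : 'I_d => inord (tnth m k) : 'I_(tnth n k).+1] => //.
by apply: eq_from_tnth => k; rewrite tnth_mktuple ffunE inordK ?ltnS.
Qed.

Lemma size_lexbox (d : nat) (n : mindex d) :
  size (lexbox n) = (\prod_(k < d) (tnth n k).+1)%N.
Proof.
rewrite size_sort size_map -cardE card_dep_ffun foldrE big_map big_enum /=.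
by apply: eq_bigr => k _; rewrite card_ord.
Qed.

(* Main.v *)
Require Import Defs.
From HB Require Import structures.
From mathcomp Require Import all_boot all_order all_algebra.
From mathcomp Require Import all_classical all_reals all_analysis.
From mathcomp Require Import complex ring zify.

(** Write l_k(x) = x^T f_k.  The product rule gives
    d_i psi_n = sum_k n_k (f_k)_i psi_(n - e_k) ([has_pderiv_psi]), because l_k
    is linear with gradient f_k.  In the drift term the gradients get paired
    with A x, and (A x)^T f_k = - conj(lambda_k) l_k(x) by conjugate
    transposition of the eigenvector equation ([hdot_eigen]), so that this term
    reproduces psi_n with the factor mu_n.  Two derivatives paired with the
    symmetric matrix Q produce a double sum over (k, l) of symmetric terms;
    its diagonal and its two equal triangular halves are the two remaining
    sums of the formula ([OU_psi]).

    The multi-indices on the right-hand side are n and the indices obtained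
    from n by lowering some entries, at most 1 + d + d(d-1)/2 in number
    ([size_OU_support]).  They stay in the box below n, which gives invariance
    ([OU_psi_comb_box]), and they are lexicographically at most n, which gives
    triangularity ([OU_coef_gt]).

    The representing matrix is unique because distinct psi_m are linearly
    independent as functions on R^d ([psi_free]).  If a combination vanishes
    at all real points, then for z = x + i y with x, y real it vanishes at
    x + s y for every natural number s; being polynomial in s, it vanishes at
    s = i, hence at z.  As the f_k form a basis, the numbers z^T f_k take
    arbitrary complex values t_k, and the substitution t_k = s^(b^k) with b
    larger than all exponents turns distinct monomials into distinct powers of
    s. *)

Set Implicit Arguments.
Unset Strict Implicit.
Unset Printing Implicit Defensive.

Import Order.TTheory GRing.Theory Num.Theory numFieldNormedType.Exports.
Local Open Scope ring_scope.
Local Open Scope sesquilinear_scope.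

(** * Partial derivatives of complex-valued functions *)

Section Calculus.
Variables (R : realType) (d : nat).
Implicit Types (i : 'I_d) (phi chi : 'cV[R]_d -> R[i]) (x : 'cV[R]_d).
Implicit Types (a D E : R[i]).

(** [phi] is differentiable at [x] along the i-th coordinate, with derivative
    [D].  Unlike the total function [pderiv], the predicate carries the
    differentiability of the real and imaginary parts, which the rules of
    calculus need. *)
Definition has_pderiv i phi x D : Prop :=
  is_derive x (delta_mx i 0 : 'cV[R]_d) (fun y => complex.Re (phi y))
    (complex.Re D) /\
  is_derive x (delta_mx i 0 : 'cV[R]_d) (fun y => complex.Im (phi y))
    (complex.Im D).

Lemma has_pderivE i phi x D : has_pderiv i phi x D -> pderiv i phi x = D.
Proof.
case=> dRe dIm; rewrite /pderiv derive_val (@derive_val _ _ _ _ _ _ _ dIm).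
by case: D dRe dIm.
Qed.

Lemma has_pderiv_cst i a x : has_pderiv i (fun=> a) x 0.
Proof. by split; apply: is_derive_cst. Qed.

Lemma has_pderivD i phi chi x D E : has_pderiv i phi x D ->
  has_pderiv i chi x E -> has_pderiv i (fun y => phi y + chi y) x (D + E).
Proof.
case=> dRe dIm [eRe eIm]; split.
  have -> : (fun y => complex.Re (phi y + chi y)) =
            (fun y => complex.Re (phi y)) + (fun y => complex.Re (chi y)).
    by apply/funext => y; rewrite !fctE; case: (phi y) (chi y) => [? ?] [? ?].
  by apply: is_derive_eq; case: D {dRe dIm} E {eRe eIm} => [? ?] [? ?].
have -> : (fun y => complex.Im (phi y + chi y)) =
          (fun y => complex.Im (phi y)) + (fun y => complex.Im (chi y)).
  by apply/funext => y; rewrite !fctE; case: (phi y) (chi y) => [? ?] [? ?].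
by apply: is_derive_eq; case: D {dRe dIm} E {eRe eIm} => [? ?] [? ?].
Qed.

Lemma has_pderivM i phi chi x D E : has_pderiv i phi x D ->
  has_pderiv i chi x E ->
  has_pderiv i (fun y => phi y * chi y) x (D * chi x + phi x * E).
Proof.
case=> dRe dIm [eRe eIm]; split.
  have -> : (fun y => complex.Re (phi y * chi y)) =
      (fun y => complex.Re (phi y)) * (fun y => complex.Re (chi y))
      - (fun y => complex.Im (phi y)) * (fun y => complex.Im (chi y)).
    by apply/funext => y; rewrite !fctE; case: (phi y) (chi y) => [? ?] [? ?].
  apply: is_derive_eq; rewrite /GRing.scale /=.
  case: D {dRe dIm} E {eRe eIm} (phi x) (chi x) => [? ?] [? ?] [? ?] [? ?] /=.
  by ring.
have -> : (fun y => complex.Im (phi y * chi y)) =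
    (fun y => complex.Re (phi y)) * (fun y => complex.Im (chi y))
    + (fun y => complex.Im (phi y)) * (fun y => complex.Re (chi y)).
  by apply/funext => y; rewrite !fctE; case: (phi y) (chi y) => [? ?] [? ?].
apply: is_derive_eq; rewrite /GRing.scale /=.
case: D {dRe dIm} E {eRe eIm} (phi x) (chi x) => [? ?] [? ?] [? ?] [? ?] /=.
by ring.
Qed.

Lemma has_pderivZ i a phi x D :
  has_pderiv i phi x D -> has_pderiv i (fun y => a * phi y) x (a * D).
Proof.
by move=> /(has_pderivM (has_pderiv_cst i a x)); rewrite mul0r add0r.
Qed.

Lemma has_pderiv_sum i (I : Type) (s : seq I) (P : pred I)
    (phi : I -> 'cV[R]_d -> R[i]) x (D : I -> R[i]) :
  (forall k, has_pderiv i (phi k) x (D k)) ->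
  has_pderiv i (fun y => \sum_(k <- s | P k) phi k y) x (\sum_(k <- s | P k) D k).
Proof.
move=> dphi; elim: s => [|k s IHs].
  rewrite big_nil (_ : (fun _ => _) = fun=> 0); first exact: has_pderiv_cst.
  by apply/funext => y; rewrite big_nil.
under boolp.eq_fun do rewrite big_cons; rewrite big_cons.
by case: (P k); [exact: has_pderivD|exact: IHs].
Qed.

Lemma has_pderiv_prod i (I : eqType) (s : seq I)
    (phi : I -> 'cV[R]_d -> R[i]) x (D : I -> R[i]) :
  uniq s -> (forall k, has_pderiv i (phi k) x (D k)) ->
  has_pderiv i (fun y => \prod_(k <- s) phi k y) x
    (\sum_(k <- s) D k * \prod_(l <- s | l != k) phi l x).
Proof.
move=> + dphi; elim: s => [_|k s IHs /= /andP[ks us]].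
  rewrite big_nil (_ : (fun _ => _) = fun=> 1); first exact: has_pderiv_cst.
  by apply/funext => y; rewrite big_nil.
under boolp.eq_fun do rewrite big_cons.
have := has_pderivM (dphi k) (IHs us).
rewrite !big_cons eqxx /= mulr_sumr.
rewrite (_ : \prod_(l <- s | l != k) _ = \prod_(l <- s) phi l x); last first.
  rewrite big_seq_cond [RHS]big_seq; apply: eq_bigl => l.
  by case: (l =P k) => [->|]; rewrite ?andbT ?(negPf ks).
congr (has_pderiv _ _ _ (_ + _)).
apply: eq_big_seq => l ls; rewrite big_cons ifT; first by ring.
by apply: contraNneq ks => ->.
Qed.

Lemma has_pderivX i phi x D n : has_pderiv i phi x D ->
  has_pderiv i (fun y => phi y ^+ n) x (n%:R * phi x ^+ n.-1 * D).
Proof.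
move=> dphi; elim: n => [|n IHn]; first by rewrite !mul0r; exact: has_pderiv_cst.
under boolp.eq_fun do rewrite exprS.
have := has_pderivM dphi IHn; congr (has_pderiv _ _ _ _) => /=.
by case: n {IHn} => [|n] /=; rewrite ?expr0 ?exprS; ring.
Qed.

Lemma is_derive_coord (l : 'I_d) x (v : 'cV[R]_d) :
  is_derive x v (fun y : 'cV[R]_d => y l 0) (v l 0).
Proof.
have cvl : ((fun h : R => h^-1 *: ((h *: v + x) l 0 - x l 0)) @ 0^'
    --> v l 0)%classic.
  apply: (@cvg_trans _ ((fun=> v l 0) @ (0 : R)^')%classic); last exact: cvg_cst.
  apply: near_eq_cvg; near=> h.
  have h0 : h != 0 by near: h; exact: nbhs_dnbhs_neq.
  by rewrite !mxE addrK /GRing.scale /= mulKf.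
split; first by apply/cvg_ex; exists (v l 0).
exact: cvg_lim.
Unshelve. all: by end_near.
Qed.

Lemma hdot_cplxE x (f : 'cV[R[i]]_d) :
  hdot (cplx x) f = \sum_(l < d) (x l 0)%:C%C * f l 0.
Proof.
rewrite /hdot !mxE; apply: eq_bigr => l _; rewrite !mxE.
by congr (_ * _); rewrite -[LHS]/(conjc _) /conjc /= oppr0.
Qed.

Lemma has_pderiv_hdot i x (f : 'cV[R[i]]_d) :
  has_pderiv i (fun y => hdot (cplx y) f) x (f i 0).
Proof.
under boolp.eq_fun do rewrite hdot_cplxE.
rewrite (_ : f i 0 = \sum_(l < d)
   ((delta_mx i 0 : 'cV[R]_d) l 0)%:C%C * f l 0); last first.
  rewrite (bigD1 i) //= big1 ?addr0 ?mxE ?eqxx ?mul1r // => l /negPf li.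
  by rewrite mxE li mul0r.
apply: has_pderiv_sum => l.
rewrite -[X in has_pderiv _ _ _ X]addr0 -[X in _ + X](mulr0 (x l 0)%:C%C).
apply: (@has_pderivM _ (fun y => (y l 0)%:C%C)); last exact: has_pderiv_cst.
by split; [exact: is_derive_coord|exact: is_derive_cst].
Qed.

End Calculus.

(** * The Ornstein-Uhlenbeck operator on products of linear forms *)

Section Generator.
Variables (R : realType) (d r : nat).
Variables (A : 'M[R]_d) (B : 'M[R]_(d, r)).
Variables (f : 'I_d -> 'cV[R[i]]_d) (lambda : 'I_d -> R[i]).
Implicit Types (n m p : mindex d) (x : 'cV[R]_d) (k l : 'I_d).

(** The multi-index n - e_k, with truncated subtraction: it is n when
    n_k = 0, in which case it only ever occurs with the coefficient n_k. *)
Definition lower1 n k : mindex d :=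
  [tuple (if l == k then tnth n l - 1 else tnth n l)%N | l < d].

Lemma lower1_lower1 n k : lower1 (lower1 n k) k = lower2 n k.
Proof.
apply: eq_from_tnth => l; rewrite !tnth_mktuple.
by case: (l == k); rewrite // -subnDA.
Qed.

Lemma lower1_lower11 n k l : k != l -> lower1 (lower1 n k) l = lower11 n k l.
Proof.
move=> kl; apply: eq_from_tnth => j; rewrite !tnth_mktuple.
by case: (j =P k) => [->|//]; rewrite (negPf kl).
Qed.

Lemma lower11C n k l : lower11 n k l = lower11 n l k.
Proof. by apply: eq_from_tnth => j; rewrite !tnth_mktuple orbC. Qed.

Lemma psi_lower1 n k x : (0 < tnth n k)%N ->
  hdot (cplx x) (f k) * psi f (lower1 n k) x = psi f n x.
Proof.
move=> nk; rewrite /psi (bigD1 k) //= [RHS](bigD1 k) //= mulrA.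
rewrite tnth_mktuple eqxx -exprS subn1 prednK //; congr (_ * _).
by apply: eq_bigr => l /negPf lk; rewrite tnth_mktuple lk.
Qed.

Lemma has_pderiv_psi i n x : has_pderiv i (psi f n) x
  (\sum_(k < d) (tnth n k)%:R * f k i 0 * psi f (lower1 n k) x).
Proof.
have := has_pderiv_prod (index_enum_uniq 'I_d)
  (fun k => has_pderivX (tnth n k) (has_pderiv_hdot i x (f k))).
congr (has_pderiv _ _ _ _); apply: eq_bigr => k _.
rewrite [psi _ _ _](bigD1 k) //= tnth_mktuple eqxx subn1.
rewrite [RHS]mulrA [X in X * _ = _]mulrAC; congr (_ * _).
by apply: eq_bigr => l /negPf lk; rewrite tnth_mktuple lk.
Qed.

Lemma has_pderiv_pderiv_psi i j n x : has_pderiv i (pderiv j (psi f n)) x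
  (\sum_(k < d) (tnth n k)%:R * f k j 0 *
    \sum_(l < d) (tnth (lower1 n k) l)%:R * f l i 0 *
       psi f (lower1 (lower1 n k) l) x).
Proof.
have -> : pderiv j (psi f n) = fun y => \sum_(k < d)
    (tnth n k)%:R * f k j 0 * psi f (lower1 n k) y.
  by apply/funext => y; exact/has_pderivE/has_pderiv_psi.
by apply: has_pderiv_sum => k; apply: has_pderivZ; exact: has_pderiv_psi.
Qed.

Lemma OU_psi_comb (s : seq (mindex d)) (c : mindex d -> R[i]) x :
  OU A B (psi_comb f s c) x = \sum_(m <- s) c m * OU A B (psi f m) x.
Proof.
have D1 i : pderiv i (psi_comb f s c) =
    fun y => \sum_(m <- s) c m * pderiv i (psi f m) y.
  apply/funext => y; apply: has_pderivE; apply: has_pderiv_sum => m.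
  apply: has_pderivZ; have dpsi := has_pderiv_psi i m y.
  by rewrite (has_pderivE dpsi).
have D2 i j : pderiv i (pderiv j (psi_comb f s c)) x =
    \sum_(m <- s) c m * pderiv i (pderiv j (psi f m)) x.
  rewrite D1; apply: has_pderivE; apply: has_pderiv_sum => m.
  apply: has_pderivZ; have dpsi := has_pderiv_pderiv_psi i j m x.
  by rewrite (has_pderivE dpsi).
rewrite /OU; under [RHS]eq_bigr do rewrite mulrDr !mulr_sumr.
rewrite big_split /=; congr (_ + _); rewrite [RHS]exchange_big /=.
  apply: eq_bigr => i _; rewrite D1 mulr_sumr.
  by apply: eq_bigr => m _; rewrite mulrCA.
apply: eq_bigr => i _; under [RHS]eq_bigr do rewrite mulr_sumr.
rewrite [RHS]exchange_big /=; apply: eq_bigr => j _; rewrite D2 mulr_sumr.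
by apply: eq_bigr => m _; rewrite mulrCA.
Qed.

Lemma conj_cplx (a b : nat) (M : 'M[R]_(a, b)) :
  map_mx Num.conj (cplx M) = cplx M.
Proof.
apply/matrixP => i j; rewrite !mxE.
by rewrite -[LHS]/(conjc _) /conjc /= oppr0.
Qed.

Lemma hdot_eigen k x : (f k)^t* *m cplx A = - lambda k *: (f k)^t* ->
  hdot (cplx (A *m x)) (f k) = - (lambda k)^* * hdot (cplx x) (f k).
Proof.
move=> fk.
have {}fk : (cplx A)^T *m f k = - (lambda k)^* *: f k.
  move/(congr1 (fun M => map_mx Num.conj M^T)): fk.
  rewrite trmx_mul map_mxM -(map_trmx _ (cplx A)) conj_cplx linearZ map_mxZ /=.
  by rewrite trmxCK rmorphN.
rewrite /hdot /cplx map_mxM -!/(cplx _) trmx_mul map_mxM /=.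
by rewrite -!map_trmx !conj_cplx -mulmxA fk -scalemxAr mxE.
Qed.

(** The bilinear, not sesquilinear, form f_k^T Q f_l. *)
Definition qform k l : R[i] :=
  hdot (map_mx Num.conj (f k)) (cplx (diffusion B) *m f l).

Lemma qformE k l : qform k l =
  \sum_(i < d) \sum_(j < d) (diffusion B i j)%:C%C * f k i 0 * f l j 0.
Proof.
rewrite /qform /hdot mxE; apply: eq_bigr => i _.
rewrite !mxE conjCK mulr_sumr; apply: eq_bigr => j _.
by rewrite mxE mulrCA mulrA.
Qed.

Lemma qformC k l : qform k l = qform l k.
Proof.
rewrite !qformE exchange_big; apply: eq_bigr => i _; apply: eq_bigr => j _.
rewrite mulrAC; congr (_%:C%C * _ * _).
rewrite /diffusion !mxE; congr (_ * _); apply: eq_bigr => a _.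
by rewrite !mxE mulrC.
Qed.

Lemma sum_sym_ord (G : 'I_d -> 'I_d -> R[i]) :
  (forall k l, G k l = G l k) ->
  \sum_(k < d) \sum_(l < d) G k l =
  \sum_(k < d) G k k + 2 * \sum_(k < d) \sum_(l < d | (k < l)%N) G k l.
Proof.
move=> symG.
have -> : \sum_(k < d) \sum_(l < d) G k l =
    \sum_(k < d) (G k k + (\sum_(l < d | (k < l)%N) G k l
                           + \sum_(l < d | (l < k)%N) G k l)).
  apply: eq_bigr => k _; rewrite (bigD1 k) //=.
  rewrite (bigID (fun l : 'I_d => (k < l)%N)) /=.
  congr (_ + (_ + _)); apply: eq_bigl => l; rewrite -val_eqE /= neq_ltn;
    by case: ltngtP.
rewrite !big_split /= mulr2n mulrDl mul1r; congr (_ + (_ + _)).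
rewrite (exchange_big_dep predT) //=; apply: eq_bigr => k _.
exact: eq_bigr.
Qed.

Lemma OU_psi n x :
  (forall k, (f k)^t* *m cplx A = - lambda k *: (f k)^t*) ->
  OU A B (psi f n) x = mu lambda n * psi f n x
    + \sum_(k < d) qform k k * (tnth n k)%:R * ((tnth n k)%:R - 1)
        * psi f (lower2 n k) x
    + 2 * \sum_(k < d) \sum_(j < d | (k < j)%N)
        qform j k * (tnth n k)%:R * (tnth n j)%:R * psi f (lower11 n k j) x.
Proof.
move=> f_eigen; rewrite -addrA /OU; congr (_ + _).
  rewrite /mu mulNr mulr_suml -sumrN.
  under eq_bigr do rewrite (has_pderivE (has_pderiv_psi _ n x)) mulr_sumr.
  rewrite exchange_big; apply: eq_bigr => k _ /=.
  transitivity ((tnth n k)%:R * hdot (cplx (A *m x)) (f k) * psi f (lower1 n k) x).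
    rewrite hdot_cplxE mulr_sumr mulr_suml; apply: eq_bigr => i _; ring.
  rewrite hdot_eigen //; case: (posnP (tnth n k)) => [->|nk].
    by rewrite !mul0r oppr0.
  by rewrite -(psi_lower1 x nk); ring.
pose G k l := qform l k * (tnth n k)%:R * (tnth (lower1 n k) l)%:R
  * psi f (lower1 (lower1 n k) l) x.
transitivity (\sum_(k < d) \sum_(l < d) G k l).
  under eq_bigr => i _.
    under eq_bigr do
      rewrite (has_pderivE (has_pderiv_pderiv_psi _ _ n x)) mulr_sumr.
    rewrite exchange_big; over.
  rewrite exchange_big; apply: eq_bigr => k _ /=.
  under eq_bigr => i _.
    under eq_bigr do rewrite !mulr_sumr.
    rewrite exchange_big; over.
  rewrite exchange_big; apply: eq_bigr => l _ /=.
  rewrite /G qformE !mulr_suml; apply: eq_bigr => i _.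
  by rewrite !mulr_suml; apply: eq_bigr => j _; ring.
rewrite sum_sym_ord => [|k l]; last first.
  have [->//|kl] := eqVneq k l; have lk : l != k by rewrite eq_sym.
  rewrite /G !lower1_lower11 // !tnth_mktuple (negPf kl) (negPf lk).
  by rewrite lower11C qformC; congr (_ * _); rewrite mulrAC.
congr (_ + 2 * _); apply: eq_bigr => k _.
  rewrite /G lower1_lower1 tnth_mktuple eqxx; congr (_ * _).
  by case: (tnth n k) => [|m]; rewrite ?mulr0 ?mul0r // subn1 /= -natr1 addrK.
apply: eq_bigr => l kl; have lk : l != k by rewrite -val_eqE /= neq_ltn kl orbT.
by rewrite /G lower1_lower11 1?eq_sym // tnth_mktuple (negPf lk).
Qed.

End Generator.

(** * Coefficients, invariance and triangularity *)

Section Coefficients.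
Variables (R : realType) (d r : nat).
Variables (A : 'M[R]_d) (B : 'M[R]_(d, r)).
Variables (f : 'I_d -> 'cV[R[i]]_d) (lambda : 'I_d -> R[i]).
Hypothesis f_eigen : forall k, (f k)^t* *m cplx A = - lambda k *: (f k)^t*.
Implicit Types (n m p : mindex d) (x : 'cV[R]_d) (k j : 'I_d).

(** The coefficient of psi_p in A psi_m.  The Kronecker symbols are summed
    because truncated lowered indices may coincide. *)
Definition OU_coef m p : R[i] :=
  mu lambda m * (p == m)%:R
  + \sum_(k < d) qform B f k k * (tnth m k)%:R * ((tnth m k)%:R - 1)
      * (p == lower2 m k)%:R
  + 2 * \sum_(k < d) \sum_(j < d | (k < j)%N)
      qform B f j k * (tnth m k)%:R * (tnth m j)%:R * (p == lower11 m k j)%:R.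

(** The formula for A psi_m as a combination over any duplicate-free list that
    contains m and the lowered indices. *)
Lemma OU_psi_coef (s : seq (mindex d)) m x : uniq s -> m \in s ->
  (forall k, lower2 m k \in s) ->
  (forall k j, (k < j)%N -> lower11 m k j \in s) ->
  OU A B (psi f m) x = psi_comb f s (OU_coef m) x.
Proof.
move=> us ms l2s l11s.
have pick a q : q \in s -> a * psi f q x =
    \sum_(p <- s) a * (p == q)%:R * psi f p x.
  move=> qs; rewrite (bigD1_seq q) //= eqxx mulr1 big1 ?addr0 // => p /negPf ->.
  by rewrite mulr0 mul0r.
rewrite (OU_psi B m x f_eigen) /psi_comb.
rewrite /OU_coef; under [RHS]eq_bigr do rewrite 2!mulrDl.
rewrite !big_split /=; congr (_ + _ + _); first exact: pick.
  under [RHS]eq_bigr do rewrite mulr_suml.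
  by rewrite exchange_big; apply: eq_bigr => k _; exact: pick.
under [RHS]eq_bigr do rewrite -mulrA mulr_suml.
rewrite -mulr_sumr exchange_big; congr (2 * _); apply: eq_bigr => k _ /=.
under [RHS]eq_bigr do rewrite mulr_suml.
by rewrite exchange_big; apply: eq_bigr => j kj; apply: pick; exact: l11s.
Qed.

Lemma lower2_le m k l : (tnth (lower2 m k) l <= tnth m l)%N.
Proof. by rewrite tnth_mktuple; case: (l == k); rewrite ?leq_subr. Qed.

Lemma lower11_le m k j l : (tnth (lower11 m k j) l <= tnth m l)%N.
Proof. by rewrite tnth_mktuple; case: (_ || _); rewrite ?leq_subr. Qed.

Lemma lexbox_lower n m p : m \in lexbox n ->
  (forall l, (tnth p l <= tnth m l)%N) -> p \in lexbox n.
Proof.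
rewrite !mem_lexbox => /forallP mn pm; apply/forallP => l.
exact: leq_trans (pm l) (mn l).
Qed.

Lemma lexbox_uniq n : uniq (lexbox n).
Proof.
rewrite sort_uniq map_inj_uniq ?enum_uniq // => g h gh.
apply/ffunP => k; apply: val_inj.
by have := congr1 (fun t => tnth t k) gh; rewrite !tnth_mktuple.
Qed.

Lemma lexbox_sorted n : sorted <%O (lexbox n).
Proof. by rewrite lt_sorted_uniq_le lexbox_uniq sort_le_sorted. Qed.

(** The lexicographic order extends the componentwise order. *)
Lemma lexi_of_le m p : (forall l, (tnth p l <= tnth m l)%N) -> (p <= m)%O.
Proof.
move=> pm; rewrite leNgt; apply/negP => /ltxi_tuplePlt[k _].
by rewrite ltEnat /= ltnNge pm.
Qed.

Lemma OU_psi_box n m x : m \in lexbox n ->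
  OU A B (psi f m) x = psi_comb f (lexbox n) (OU_coef m) x.
Proof.
move=> mn; apply: OU_psi_coef => //; first exact: lexbox_uniq.
  by move=> k; apply: (lexbox_lower mn) => l; exact: lower2_le.
by move=> k j _; apply: (lexbox_lower mn) => l; exact: lower11_le.
Qed.

Lemma OU_coef_gt m p : (m < p)%O -> OU_coef m p = 0.
Proof.
move=> mp.
have neq q : (forall l, (tnth q l <= tnth m l)%N) -> (p == q) = false.
  by move=> /lexi_of_le qm; apply/negbTE; rewrite gt_eqF // (le_lt_trans qm).
rewrite /OU_coef neq // mulr0 add0r !big1 ?mulr0 ?addr0 // => k _.
  by rewrite big1 // => j _; rewrite neq ?mulr0 // => l; exact: lower11_le.
by rewrite neq ?mulr0 // => l; exact: lower2_le.
Qed.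

Lemma OU_psi_comb_box n (c : mindex d -> R[i]) x :
  OU A B (psi_comb f (lexbox n) c) x =
  psi_comb f (lexbox n) (fun p => \sum_(m <- lexbox n) c m * OU_coef m p) x.
Proof.
rewrite OU_psi_comb /psi_comb.
under [RHS]eq_bigr do rewrite mulr_suml.
rewrite exchange_big; apply: eq_big_seq => m mn /=.
rewrite (OU_psi_box x mn) mulr_sumr.
by apply: eq_bigr => p _; rewrite mulrA.
Qed.

(** The indices that may occur in A psi_n, possibly with repetitions. *)
Definition OU_support n : seq (mindex d) :=
  n :: [seq lower2 n k | k <- enum 'I_d]
    ++ flatten [seq [seq lower11 n k j | k in [pred k : 'I_d | (k < j)%N]]
                 | j <- enum 'I_d].

Lemma card_ord_lt j : #|[pred k : 'I_d | (k < j)%N]| = j.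
Proof.
have widen_inj : injective (widen_ord (ltnW (ltn_ord j))).
  by move=> k l /(congr1 val) kl; exact: val_inj.
rewrite -[RHS]card_ord -(card_imset _ widen_inj).
apply: eq_card => k; rewrite inE; apply/idP/imsetP => [kj|[l _ ->]] /=.
  by exists (Ordinal kj) => //; exact: val_inj.
exact: ltn_ord.
Qed.

Lemma size_OU_support n : size (OU_support n) = ((d ^ 2 + d + 2) %/ 2)%N.
Proof.
rewrite /= size_cat size_map size_enum_ord size_flatten /shape -map_comp.
rewrite sumnE big_map big_enum /=.
under eq_bigr => j _ do rewrite size_map -cardE card_ord_lt.
rewrite -(big_mkord xpredT id) bin2_sum bin2.
have := odd_double_half (d * d.-1); rewrite oddM.
rewrite (_ : odd d && _ = false); last by case: (d) => //= e; case: odd.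
rewrite add0n -addnn => dd.
have -> : (d ^ 2 + d + 2 = ((d * d.-1)./2 + d + 1) * 2)%N.
  by case: (d) dd => [|e] /=; lia.
by rewrite mulnK // addn1 addnC.
Qed.

Lemma OU_psi_support n x :
  OU A B (psi f n) x = psi_comb f (undup (OU_support n)) (OU_coef n) x.
Proof.
apply: OU_psi_coef => [| |k|k j kj]; rewrite ?undup_uniq // mem_undup /OU_support.
- by rewrite inE eqxx.
- by rewrite inE mem_cat map_f ?orbT // mem_enum.
- rewrite inE mem_cat; apply/orP; right; apply/orP; right.
  apply/flatten_mapP; exists j; rewrite ?mem_enum //.
  by apply/fintype.imageP; exists k.
Qed.

End Coefficients.

(** * Linear independence of the functions psi *)

Section Independence.

Lemma poly_nat_roots (K : numDomainType) (p : {poly K}) :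
  (forall s : nat, p.[s%:R] = 0) -> p = 0.
Proof.
move=> p0; apply: (@roots_geq_poly_eq0 _ _ [seq s%:R | s <- iota 0 (size p)]).
- by apply/allP => _ /mapP[s _ ->]; rewrite /root p0.
- by rewrite map_inj_uniq ?iota_uniq //; exact: mulrIn (oner_neq0 K).
- by rewrite size_map size_iota.
Qed.

(** Uniqueness of the base-b expansion with d digits. *)
Lemma expansion_inj (d b : nat) (g h : 'I_d -> nat) :
  (forall k, g k < b)%N -> (forall k, h k < b)%N ->
  (\sum_(k < d) g k * b ^ k = \sum_(k < d) h k * b ^ k)%N -> g =1 h.
Proof.
elim: d => [|d IHd] in g h * => gb hb; first by move=> _ [].
have E (u : 'I_d.+1 -> nat) : (\sum_(k < d.+1) u k * b ^ k =
    (\sum_(k < d) u (lift ord0 k) * b ^ k) * b + u ord0)%N.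
  rewrite big_ord_recl muln1 addnC big_distrl; congr (_ + _)%N.
  by apply: eq_bigr => k _; rewrite /= expnSr mulnA.
rewrite !E => gh.
have gh0 : g ord0 = h ord0.
  by have := congr1 (modn^~ b) gh; rewrite !modnMDl !modn_small.
move: gh; rewrite gh0 => /addIn/eqP.
rewrite eqn_pmul2r ?(leq_trans _ (gb ord0)) // => /eqP gh k.
by case: (unliftP ord0 k) => [j ->|->//]; apply: IHd gh j => j.
Qed.

(** Distinct monomials are linearly independent as functions.  Proved by
    Kronecker substitution: t_k = s^(b^k) sends the monomial of exponent e i
    to s^(w i), where w i has base-b digits e i. *)
Lemma monomials_free (K : numDomainType) (d : nat) (I : finType)
    (e : I -> 'I_d -> nat) (c : I -> K) :
  (forall i j, e i =1 e j -> i = j) ->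
  (forall t : 'I_d -> K, \sum_i c i * \prod_k t k ^+ e i k = 0) ->
  forall i, c i = 0.
Proof.
move=> e_inj c0.
pose b := (\max_i \max_k e i k).+1.
have eb i k : (e i k < b)%N.
  rewrite ltnS; apply: (leq_trans _ (leq_bigmax (F := fun i => \max_k e i k) i)).
  exact: (leq_bigmax (F := e i) k).
pose w i := (\sum_k e i k * b ^ k)%N.
have w_inj : injective w.
  by move=> i j /expansion_inj ij; apply: e_inj; exact: ij.
have p0 : \sum_i (c i)%:P * 'X^(w i) = 0.
  apply: poly_nat_roots => s; rewrite -[RHS](c0 (fun k => s%:R ^+ (b ^ k))).
  rewrite horner_sum; apply: eq_bigr => i _.
  rewrite hornerM hornerC hornerXn /w -prodrXr.
  by congr (_ * _); apply: eq_bigr => k _; rewrite -exprM mulnC.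
move=> i; have := congr1 (fun p : {poly K} => p`_(w i)) p0.
rewrite coef_sum coef0 (bigD1 i) //= coefCM coefXn eqxx mulr1 big1 ?addr0 //.
by move=> j ji; rewrite coefCM coefXn (inj_eq w_inj) eq_sym (negPf ji) mulr0.
Qed.

Variables (R : realType) (d : nat) (f : 'I_d -> 'cV[R[i]]_d).
Hypothesis f_basis : basis_of fullv [seq f k | k <- enum 'I_d].

(** For a basis f, the bilinear coordinates z^T f_k can be prescribed. *)
Lemma basis_coordinates (t : 'I_d -> R[i]) :
  exists z : 'cV[R[i]]_d, forall k, \sum_(l < d) z l 0 * f k l 0 = t k.
Proof.
pose F : 'M[R[i]]_d := \matrix_(k, l) f k l 0.
have F_unit : F \in unitmx.
  rewrite -row_free_unit -kermx_eq0; apply/rowV0P => v /sub_kermxP vF.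
  have /freeP free_f : free [tuple f k | k < d].
    by rewrite /= (basis_free f_basis).
  apply/rowP => k; rewrite mxE; apply: (free_f (fun k => v 0 k)).
  apply/colP => l; have := congr1 (fun M : 'rV_d => M 0 l) vF.
  rewrite !mxE summxE => vFl; rewrite -[RHS]vFl; apply: eq_bigr => j _.
  by rewrite -tnth_nth tnth_mktuple !mxE.
exists (invmx F *m \col_k t k) => k.
have := congr1 (fun M : 'cV_d => M k 0) (mulKVmx F_unit (\col_k t k)).
rewrite mxE [RHS]mxE => <-; apply: eq_bigr => l _.
by rewrite [F _ _]mxE mulrC.
Qed.

Lemma psi_free (I : finType) (e : I -> mindex d) (c : I -> R[i]) :
  injective e ->
  (forall x : 'cV[R]_d, \sum_i c i * psi f (e i) x = 0) ->
  forall i, c i = 0.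
Proof.
move=> e_inj c0; apply: (@monomials_free _ d _ (fun i k => tnth (e i) k)).
  by move=> i j ij; apply/e_inj/eq_from_tnth.
move=> t; have [z zt] := basis_coordinates t.
pose x : 'cV[R]_d := map_mx (@complex.Re R) z.
pose y : 'cV[R]_d := map_mx (@complex.Im R) z.
(* p(s) is the value of the combination at x + s y, for real s; and
   z = x + 'i y is reached at s = 'i. *)
pose p : {poly R[i]} := \sum_i (c i)%:P * \prod_k
  ((hdot (cplx x) (f k))%:P + (hdot (cplx y) (f k))%:P * 'X) ^+ tnth (e i) k.
have pE s : p.[s] = \sum_i c i * \prod_k
    (hdot (cplx x) (f k) + hdot (cplx y) (f k) * s) ^+ tnth (e i) k.
  rewrite horner_sum; apply: eq_bigr => i _; rewrite hornerM hornerC.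
  rewrite horner_prod; congr (_ * _); apply: eq_bigr => k _.
  by rewrite horner_exp !hornerE.
have p0 : p = 0.
  apply: poly_nat_roots => s; rewrite pE -[RHS](c0 (x + s%:R *: y)).
  apply: eq_bigr => i _; congr (_ * _); apply: eq_bigr => k _; congr (_ ^+ _).
  rewrite !hdot_cplxE mulr_suml -big_split; apply: eq_bigr => l _ /=.
  by rewrite !mxE rmorphD rmorphM rmorph_nat; ring.
rewrite -[RHS](horner0 'i%C) -p0 pE; apply: eq_bigr => i _.
congr (_ * _); apply: eq_bigr => k _; congr (_ ^+ _).
rewrite !hdot_cplxE mulr_suml -big_split -zt; apply: eq_bigr => l _ /=.
by rewrite !mxE [in LHS](complexE (z l 0)); ring.
Qed.

End Independence.

(** * The matrix of the operator *)

Lemma represents_unique (R : realType) (d r N : nat) (A : 'M[R]_d)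
    (B : 'M[R]_(d, r)) (f : 'I_d -> 'cV[R[i]]_d) (n : mindex d)
    (M M' : 'M[R[i]]_N) :
  basis_of fullv [seq f k | k <- enum 'I_d] -> size (lexbox n) = N ->
  represents A B f n M -> represents A B f n M' -> M' = M.
Proof.
move=> f_basis sN repM repM'; apply/matrixP => i j; apply/eqP.
rewrite -subr_eq0; apply/eqP.
apply: (psi_free f_basis (e := fun i : 'I_N => nth n (lexbox n) i)
  (c := fun i => M' i j - M i j)) => [k l /eqP|x].
  by rewrite nth_uniq ?sN ?lexbox_uniq // => /eqP; exact: val_inj.
under eq_bigr do rewrite mulrBl.
by rewrite big_split sumrN /= -repM -repM' subrr.
Qed.

Theorem mainTheorem2 (R : realType) (d r : nat)
    (A : 'M[R]_d) (B : 'M[R]_(d, r))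
    (f : 'I_d -> 'cV[R[i]]_d) (lambda : 'I_d -> R[i])
    (A_diag : diagonalizable (cplx A))
    (A_stable : forall a : R[i], eigenvalue (cplx A) a -> complex.Re a < 0)
    (le_rd : (r <= d)%N)
    (AB_ctrl : forall (v : 'cV[R[i]]_d) (a : R[i]),
        v != 0 -> v^t* *m cplx A = a *: v^t* -> (cplx B)^T *m v != 0)
    (f_basis : basis_of fullv [seq f k | k <- enum 'I_d])
    (f_eigen : forall k : 'I_d, (f k)^t* *m cplx A = - lambda k *: (f k)^t*) :
  [/\ (forall (n : mindex d) (x : 'cV[R]_d),
        OU A B (psi f n) x =
          mu lambda n * psi f n x
          + \sum_(k < d)
              hdot (map_mx Num.conj (f k)) (cplx (diffusion B) *m f k)
              * (tnth n k)%:R * ((tnth n k)%:R - 1) * psi f (lower2 n k) x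
          + 2 * \sum_(k < d) \sum_(j < d | (k < j)%N)
              hdot (map_mx Num.conj (f j)) (cplx (diffusion B) *m f k)
              * (tnth n k)%:R * (tnth n j)%:R * psi f (lower11 n k j) x),
      (forall n : mindex d,
        exists (s : seq (mindex d)) (c : mindex d -> R[i]),
          [/\ uniq s,
              (size s <= (d ^ 2 + d + 2) %/ 2)%N
            & OU A B (psi f n) =1 psi_comb f s c])
    & (forall n : mindex d,
        let N := (\prod_(k < d) (tnth n k).+1)%N in
        [/\ size (lexbox n) = N,
            (forall c : mindex d -> R[i],
               exists c' : mindex d -> R[i],
                 OU A B (psi_comb f (lexbox n) c) =1 psi_comb f (lexbox n) c')
          & exists M : 'M[R[i]]_N,
              [/\ represents A B f n M,
                  (forall M' : 'M[R[i]]_N, represents A B f n M' -> M' = M)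
                & (forall i j : 'I_N, (j < i)%N -> M i j = 0)]])].
Proof.
split=> [n x|n|n N]; first exact: OU_psi.
  exists (undup (OU_support n)), (OU_coef B f lambda n); split.
  - exact: undup_uniq.
  - by rewrite -(size_OU_support n) size_undup.
  - by move=> x; exact: OU_psi_support.
have sN : size (lexbox n) = N by exact: size_lexbox.
split=> // [c|].
  exists (fun p => \sum_(m <- lexbox n) c m * OU_coef B f lambda m p) => x.
  exact: OU_psi_comb_box.
pose M : 'M[R[i]]_N := \matrix_(i, j)
  OU_coef B f lambda (nth n (lexbox n) j) (nth n (lexbox n) i).
have repM : represents A B f n M.
  move=> j x; rewrite (OU_psi_box (n := n) B f_eigen) ?mem_nth ?sN //.
  rewrite /psi_comb (big_nth n) sN big_mkord.
  by apply: eq_bigr => i _; rewrite mxE.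
exists M; split=> // [M' repM'|i j ji].
  exact: (represents_unique f_basis sN repM repM').
rewrite mxE; apply: OU_coef_gt.
by rewrite lt_sorted_ltn_nth ?inE ?sN //; exact: lexbox_sorted.
Qed.
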